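(* Let $\Sigma$ be a compact hypersurface in the Euclidean space $\mathbb{R}^{n+1}$ with non-empty boundary $\partial\Sigma$. If $\Sigma$ is not contained in the convex hull $\mathrm{conv}(\partial\Sigma)$ of its boundary, then $\Sigma$ has an elliptic point.
   Context: Hypersurfaces are smooth and connected, of dimension $n$. A point $p\in\Sigma$ is elliptic if all the principal curvatures of $\Sigma$ at $p$ (eigenvalues of the shape operator $A X=-\overline\nabla_X N$, where $N$ is a local unit normal field and $\overline\nabla$ is the Levi-Civita connection of $\mathbb{R}^{n+1}$) have the same sign, i.e. they are all strictly positive or all strictly negative; this does not depend on the choice of $N$. *)

(* Defs.v *)
From HB Require Import structures.
From mathcomp Require Import all_boot all_order all_algebra.
From mathcomp Require Import all_classical all_reals all_analysis.
Set Implicit Arguments.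
Unset Strict Implicit.
Unset Printing Implicit Defensive.
Import Order.TTheory GRing.Theory Num.Theory.
Import numFieldNormedType.Exports.
Local Open Scope classical_set_scope.
Local Open Scope ring_scope.

(** Euclidean space is ['rV[R]_m]; vectors are rows, so
    linear maps are represented by matrices acting on the right. *)

(** [C_on k U f] : [f] is of class C^k on the open set [U]. *)
Fixpoint C_on {R : realType} {V W : normedModType R} (k : nat) (U : set V)
    (f : V -> W) : Prop :=
  match k with
  | 0 => forall x, U x -> {for x, continuous f}
  | k'.+1 => (forall x, U x -> differentiable f x) /\
             (forall v, C_on k' U (fun x => 'd f x v))
  end.

Definition smooth_on {R : realType} {V W : normedModType R} (U : set V)
    (f : V -> W) : Prop := forall k, C_on k U f.

(** [G] is a smooth function near [x] that agrees on [S] with [g]; this is how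
    smoothness, and derivatives, of functions on a half-space are defined. *)
Definition smooth_extension {R : realType} {V W : normedModType R} (S : set V)
    (g : V -> W) (x : V) (G : V -> W) : Prop :=
  exists U : set V, [/\ open_nbhs x U, smooth_on U G &
    forall y, U y -> S y -> G y = g y].

(** The condition on [i] selects the first coordinate; for [n = 0] there is
    none, and the half-space is the whole (one-point) space, with empty edge. *)
Definition half_space {R : realType} {n : nat} : set 'rV[R]_n :=
  [set x | forall i : 'I_n, i = 0%N :> nat -> 0 <= x 0 i].

Definition half_space_edge {R : realType} {n : nat} : set 'rV[R]_n :=
  [set x | exists i : 'I_n, i = 0%N :> nat /\ x 0 i = 0].

Record chart (R : realType) (n : nat) (M : topologicalType) := Chart {
  cdom : set M ;
  cmap : M -> 'rV[R]_n ;
  cinv : 'rV[R]_n -> M ;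
  cdom_open : open cdom ;
  cmap_image : exists2 W, open W & cmap @` cdom = W `&` half_space ;
  cmapK : forall p, cdom p -> cinv (cmap p) = p ;
  cmap_continuous : {within cdom, continuous cmap} ;
  cinv_continuous : {within cmap @` cdom, continuous cinv} }.

(** Smooth n-manifolds with (possibly empty) boundary.  The atlas need not be
    maximal. *)
Record manifold (R : realType) (n : nat) := Manifold {
  carrier :> topologicalType ;
  atlas : set (chart R n carrier) ;
  carrier_hausdorff : hausdorff_space carrier ;
  carrier_second_countable : @second_countable carrier ;
  atlas_cover : forall p : carrier, exists2 c, atlas c & cdom c p ;
  atlas_compatible : forall c1 c2, atlas c1 -> atlas c2 ->
    forall p, cdom c1 p -> cdom c2 p ->
    exists G, smooth_extension (cmap c1 @` (cdom c1 `&` cdom c2))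
                (cmap c2 \o cinv c1) (cmap c1 p) G }.

Section Hypersurfaces.
Context {R : realType} {n : nat} {M : manifold R n}.

Definition boundary : set M :=
  [set p | exists c, [/\ atlas c, cdom c p & half_space_edge (cmap c p)]].

Definition smooth_at {m : nat} (g : M -> 'rV[R]_m) (p : M) : Prop :=
  forall c, atlas c -> cdom c p ->
  exists G, smooth_extension (cmap c @` cdom c) (g \o cinv c) (cmap c p) G.

(** [J] is the Jacobian matrix at [p] of [g] read in the chart [c].  At a
    boundary point it does not depend on the extension, because the image of a
    chart is relatively open in the half-space. *)
Definition chart_jacobian {m : nat} (c : chart R n M) (g : M -> 'rV[R]_m)
    (p : M) (J : 'M[R]_(n, m)) : Prop :=
  exists2 G, smooth_extension (cmap c @` cdom c) (g \o cinv c) (cmap c p) G &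
    J = 'J G (cmap c p).

(** [row_free J] says that the linear map [v |-> v *m J] is injective. *)
Definition immersion {m : nat} (f : M -> 'rV[R]_m) : Prop :=
  forall c p, atlas c -> cdom c p ->
  exists2 J, chart_jacobian c f p J & row_free J.

Definition unit_normal_near (f N : M -> 'rV[R]_n.+1) (p : M) : Prop :=
  \forall q \near p,
    [/\ smooth_at N q,
        N q *m (N q)^T = 1%:M &
        forall c J, atlas c -> cdom c q -> chart_jacobian c f q J ->
          J *m (N q)^T = 0].

(** [A] is the matrix, in the coordinate basis of the tangent space at [p]
    given by [c], of the shape operator [X |-> - D_X N]: a tangent vector is
    [X = v *m Jf] with [v] a row of coordinates, and the equation below reads
    [(v *m A) *m Jf = - D_X N] for every [v]. *)
Definition shape_operator (c : chart R n M) (f N : M -> 'rV[R]_n.+1) (p : M)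
    (A : 'M[R]_n) : Prop :=
  exists Jf JN, [/\ chart_jacobian c f p Jf, chart_jacobian c N p JN &
    A *m Jf = - JN].

Definition elliptic (f : M -> 'rV[R]_n.+1) (p : M) : Prop :=
  exists N c A, [/\ unit_normal_near f N p, atlas c, cdom c p,
    shape_operator c f N p A &
    (forall k, eigenvalue A k -> 0 < k) \/
    (forall k, eigenvalue A k -> k < 0)].

End Hypersurfaces.
Arguments boundary {R n} M.

Definition conv_hull {R : realType} {V : lmodType R} (A : set V) : set V :=
  smallest (@convex_set R V) A.

(* Main.v *)
Require Import Defs.
From HB Require Import structures.
From mathcomp Require Import all_boot all_order all_algebra.
From mathcomp Require Import all_classical all_reals all_analysis.
From mathcomp Require Import ring lra.

(** Why the theorem holds. Let [K = f @` boundary M] and let [q0] be a point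
    with [f q0] outside the convex hull of [K]. The hull of a compact set is
    compact ([conv_hull_compact]), hence strictly separated from [f q0] by a
    hyperplane; bending that hyperplane into a sphere of large radius gives a
    centre [o] from which [f q0] is farther away than every point of [K]
    ([sphere_separation]). The squared distance to [o] attains its maximum on
    the compact [M] at a point [p], and [p] is not on the boundary because
    [f q0] beats [K].

    At [p] the image lies inside the sphere centred at [o] through [f p] and
    touches it there, so it is curved at least as much as that sphere. In
    formulas, let [F] be [f] read in a chart at [x], let [w = F x - o], and let
    [N] be a unit normal field with [w + r *: N x = 0], [r = |w| > 0]. The first
    derivative of [|F - o|^2] vanishes at [x], so that [w] is normal
    ([position_normal_at_max]). Half of the second derivative in the direction
    [v] is the derivative of [<F - o, dF v> = <F - o + r N, dF v>]; the left
    factor vanishes at [x], so this equals [|dF v|^2 + r <dN v, dF v>], which is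
    therefore nonpositive ([second_order_at_max]). For an eigenvector [v] of the
    shape operator with eigenvalue [k] one has [dN v = - k dF v], whence
    [r k >= 1] and [k > 0] ([farthest_point_elliptic]).

    Two points need care. A smooth unit normal field must exist near [p]: it is
    the normalised generalised cross product of the rows of the Jacobian,
    a polynomial in the first derivatives of [F] ([normal_field]). And
    compactness of [K] requires the boundary to be closed, which rests on the
    fact that a point is on the edge of the half-space in one chart if and only
    if it is in every chart ([boundary_invariance]). *)

Set Implicit Arguments.
Unset Strict Implicit.
Unset Printing Implicit Defensive.
Import Order.TTheory GRing.Theory Num.Theory.
Import numFieldNormedType.Exports.
Local Open Scope classical_set_scope.
Local Open Scope ring_scope.

(** * Convex hulls of compact sets *)

Lemma continuous_sum {R : numFieldType} {T : topologicalType}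
    {V : normedModType R} (N : nat) (F : 'I_N -> T -> V) (x : T) :
  (forall i, {for x, continuous (F i)}) ->
  {for x, continuous (fun y => \sum_i F i y)}.
Proof. by move=> cF; apply: cvg_big => [|i _]; [exact: add_continuous|exact: cF]. Qed.

(** The coefficients are allowed in any topological space, since below matrices
    of points serve as families of points. *)
Lemma mx_entry_continuous {T : topologicalType} m n i j :
  continuous (fun M : 'M[T]_(m, n) => M i j).
Proof.
move=> M A MA.
exists (fun i' j' => if (i' == i) && (j' == j) then A else setT).
  by move=> i' j'; case: ifPn => [/andP[/eqP-> /eqP->]//|_]; exact: filterT.
by move=> N /(_ i j); rewrite !eqxx.
Qed.

Section ConvexHull.
Context {R : realType} {m : nat}.
Implicit Types (K : set 'rV[R]_m) (y : 'rV[R]_m).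

Definition convex_comb K (N : nat) : set 'rV[R]_m :=
  [set y | exists a : 'I_N -> R, exists X : 'I_N -> 'rV[R]_m,
    [/\ forall i, 0 <= a i, \sum_i a i = 1, forall i, K (X i) &
        y = \sum_i a i *: X i]].

(** Padding with a zero weight needs a point of [K] to repeat; for [N = 0] there
    is none, but an empty sum of weights cannot be 1. *)
Lemma convex_combS K N : convex_comb K N `<=` convex_comb K N.+1.
Proof.
case: N => [y [a [X [_ + _ _]]]|N y [a [X [a0 a1 KX ->]]]].
  by rewrite big_ord0 => /esym/eqP; rewrite oner_eq0.
exists (fun i => if unlift ord0 i is Some j then a j else 0).
exists (fun i => if unlift ord0 i is Some j then X j else X ord0).
split=> [i|||].
- by case: unliftP.
- by rewrite big_ord_recl unlift_none add0r -a1; apply: eq_bigr => i _;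
    rewrite liftK.
- by move=> i; case: unliftP.
- rewrite [RHS]big_ord_recl unlift_none scale0r add0r; apply: eq_bigr => i _.
  by rewrite liftK.
Qed.

(** More than [m.+1] points of an [m]-dimensional space are affinely dependent;
    moving the weights along an affine relation until one of them vanishes
    removes a point. *)
Lemma convex_comb_drop K N : (m.+1 <= N)%N ->
  convex_comb K N.+1 `<=` convex_comb K N.
Proof.
move=> mN y [a [X [a0 a1 KX ->]]].
(* The column of ones makes the left kernel consist of affine relations. *)
pose A : 'M[R]_(N.+1, 1 + m) :=
  \matrix_(i, j) row_mx (const_mx 1 : 'rV[R]_1) (X i) 0 j.
have /rowV0Pn[b bker b0] : kermx A != 0.
  rewrite -mxrank_eq0 mxrank_ker -lt0n subn_gt0.
  by rewrite (leq_ltn_trans (rank_leq_col A)).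
have {}bker : b *m A = 0 by apply/sub_kermxP.
have sb : \sum_i b 0 i = 0.
  have /matrixP/(_ 0 (lshift m 0)) := bker; rewrite mxE [RHS]mxE => h.
  by rewrite -[RHS]h; apply: eq_bigr => i _; rewrite [A _ _]mxE row_mxEl mxE mulr1.
have sbX : \sum_i b 0 i *: X i = 0.
  apply/rowP => j; have /matrixP/(_ 0 (rshift 1 j)) := bker; rewrite mxE [RHS]mxE => h.
  rewrite [RHS]mxE -[RHS]h summxE; apply: eq_bigr => i _.
  by rewrite mxE [A _ _]mxE row_mxEr.
have [i0 bi0] : exists i, 0 < b 0 i.
  apply: contrapT => /forallNP bn; move/negP: b0; apply; apply/eqP/rowP => j.
  have := @psumr_eq0P R 'I_N.+1 xpredT (fun i => - b 0 i).
  rewrite sumrN sb oppr0 => /(_ _ erefl j isT) h.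
  rewrite mxE; apply: oppr_inj; rewrite oppr0; apply: h => i _.
  by rewrite oppr_ge0 leNgt; apply/negP.
(* The first weight to vanish is the one with the least ratio to [b]. *)
case: (@Order.TotalTheory.arg_minP _ _ _ i0 (fun i => 0 < b 0 i)
   (fun i => a i / b 0 i) bi0) => i1 bi1 i1min.
pose t := a i1 / b 0 i1.
have t0 : 0 <= t by rewrite divr_ge0// ltW.
pose a' i := a i - t * b 0 i.
have a'i1 : a' i1 = 0 by rewrite /a' /t divfK ?subrr// gt_eqF.
have a'0 i : 0 <= a' i.
  rewrite subr_ge0; have [bi|bi] := ltP 0 (b 0 i).
    by rewrite -ler_pdivlMr//; apply: i1min.
  by rewrite (le_trans _ (a0 i))// mulr_ge0_le0.
have sa' : \sum_i a' i = 1 by rewrite sumrB -mulr_sumr sb mulr0 subr0.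
have saX : \sum_i a i *: X i = \sum_i a' i *: X i.
  under [RHS]eq_bigr do rewrite scalerBl -scalerA.
  by rewrite sumrB -scaler_sumr sbX scaler0 subr0.
exists (a' \o lift i1), (X \o lift i1); split => //=.
- by move: sa'; rewrite (bigD1_ord i1)//= a'i1 add0r.
- by rewrite saX (bigD1_ord i1)//= a'i1 scale0r add0r.
Qed.

Lemma caratheodory K N : convex_comb K N `<=` convex_comb K m.+1.
Proof.
have [Nm|mN] := leqP N m.+1.
  rewrite -(subnKC Nm); elim: (_ - _)%N => [|k IH]; first by rewrite addn0.
  by rewrite addnS; apply: subset_trans IH _; exact: convex_combS.
rewrite -(subnKC (ltnW mN)); elim: (_ - _)%N => [|k IH]; first by rewrite addn0.
by rewrite addnS; apply: subset_trans IH; apply: convex_comb_drop; rewrite leq_addr.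
Qed.

Lemma convex_comb_conv K N1 N2 (x y : 'rV[R]_m) (t : R) : 0 <= t -> t <= 1 ->
  convex_comb K N1 x -> convex_comb K N2 y ->
  convex_comb K (N1 + N2) (t *: x + (1 - t) *: y).
Proof.
move=> t0 t1 [a [X [a0 a1 KX ->]]] [b [Y [b0 b1 KY ->]]].
exists (fun i : 'I_(N1 + N2) =>
  match fintype.split i with inl j => t * a j | inr j => (1 - t) * b j end).
exists (fun i : 'I_(N1 + N2) =>
  match fintype.split i with inl j => X j | inr j => Y j end).
have sl (j : 'I_N1) : fintype.split (lshift N2 j) = inl j := unsplitK (inl j).
have sr (j : 'I_N2) : fintype.split (rshift N1 j) = inr j := unsplitK (inr j).
split.
- by move=> i; case: fintype.split => j; rewrite mulr_ge0// subr_ge0.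
- rewrite big_split_ord/=; under eq_bigr do rewrite sl.
  under [X in _ + X]eq_bigr do rewrite sr.
  by rewrite -!mulr_sumr a1 b1 !mulr1 addrC subrK.
- by move=> i; case: fintype.split.
- rewrite big_split_ord/=; under [X in _ = X + _]eq_bigr do rewrite sl -scalerA.
  under [X in _ = _ + X]eq_bigr do rewrite sr -scalerA.
  by rewrite -!scaler_sumr.
Qed.

Lemma conv_hull_convex_comb K : conv_hull K `<=` convex_comb K m.+1.
Proof.
apply: smallest_sub.
- move=> x y l; rewrite !inE => Kx Ky.
  have [l0 l1] : 0 <= l%:num /\ l%:num <= 1 by split.
  exact: (caratheodory (convex_comb_conv l0 l1 Kx Ky)).
- move=> x Kx; apply: (@caratheodory _ 1); exists (fun=> 1), (fun=> x).
  by split => //; rewrite big_ord1// scale1r.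
Qed.

Lemma convex_comb_conv_hull K N : convex_comb K N `<=` conv_hull K.
Proof.
move=> y Ky B /= [Bconv KB]; move: Ky.
elim: N y => [|N IH] y [a [X [a0 a1 KX ->]]].
  by move: a1; rewrite big_ord0 => /esym/eqP; rewrite oner_eq0.
move: a1; rewrite !big_ord_recl/=.
set s := \sum_(i < N) _ => a1; set z := \sum_(i < N) _.
have s0 : 0 <= s by apply: sumr_ge0.
have [s00|sn0] := eqVneq s 0.
  have -> : z = 0.
    rewrite /z big1// => i _.
    suff -> : a (lift ord0 i) = 0 by rewrite scale0r.
    apply/eqP; move/eqP: s00; rewrite psumr_eq0// => /allP/(_ i).
    by rewrite mem_index_enum => /(_ isT).
  have -> : a ord0 = 1 by rewrite -a1 s00 addr0.
  by rewrite scale1r addr0; apply: KB.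
have Bz : B (s^-1 *: z).
  apply: IH; exists (fun i => s^-1 * a (lift ord0 i)), (fun i => X (lift ord0 i)).
  split => //.
  - by move=> i; rewrite mulr_ge0 ?invr_ge0.
  - by rewrite -mulr_sumr mulVf.
  - by rewrite /z scaler_sumr; apply: eq_bigr => i _; rewrite scalerA.
have a01 : 0 <= a ord0 <= 1 by rewrite a0/= -a1 lerDl.
have := @Bconv (X ord0) (s^-1 *: z) (Itv01 (a0 ord0) (proj2 (andP a01))).
rewrite !inE => /(_ (KB _ (KX _)) Bz); congr B; congr (_ + _).
change ((1 - a ord0) *: (s^-1 *: z) = z).
by rewrite -a1 [a ord0 + _]addrC addrK scalerA mulfV// scale1r.
Qed.

(** Combinations of a fixed number of points are the continuous image of the
    product of a simplex and a power of [K]; this is why the number of points has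
    to be bounded first. *)
Lemma convex_comb_compact K N : compact K -> compact (convex_comb K N).
Proof.
move=> cK.
pose S := [set a : 'rV[R]_N | forall i, `[0, 1]%classic (a 0 i)]
  `&` [set a | \sum_i a 0 i = 1].
pose T := [set X : 'rV['rV[R]_m]_N | forall i, K (X 0 i)].
have cT : compact T by apply: (@rV_compact _ _ (fun=> K)).
have cS : compact S.
  apply: compact_closedI.
    by apply: (@rV_compact R N (fun=> `[0, 1]%classic)) => _; exact: segment_compact.
  apply: (@closed_comp _ _ (fun a : 'rV[R]_N => \sum_i a 0 i) [set 1]).
    by move=> a _; apply: continuous_sum => i; apply: coord_continuous.
  exact: closed_eq.
pose g (p : 'rV[R]_N * 'rV['rV[R]_m]_N) := \sum_i p.1 0 i *: p.2 0 i.
have cg : continuous g.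
  move=> p; apply: continuous_sum => i; apply: continuousZ.
    apply: (@continuous_comp _ _ _ fst (fun a : 'rV[R]_N => a 0 i)); first exact: cvg_fst.
    exact: mx_entry_continuous.
  apply: (@continuous_comp _ _ _ snd (fun a : 'rV['rV[R]_m]_N => a 0 i)); first exact: cvg_snd.
  exact: mx_entry_continuous.
suff -> : convex_comb K N = g @` (S `*` T).
  apply: continuous_compact; last exact: compact_setX.
  exact: continuous_subspaceT.
apply/seteqP; split => y.
  move=> [a [X [a0 a1 KX ->]]]; exists (\row_i a i, \row_i X i).
    split; last by move=> i /=; rewrite mxE.
    split => /=; last by under eq_bigr do rewrite mxE.
    move=> i; rewrite mxE in_itv/= a0 -a1 (bigD1 i)//= lerDl.
    exact: sumr_ge0.
  by rewrite /g/=; apply: eq_bigr => i _; rewrite !mxE.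
move=> [[a X] [[/= a01 a1] KX] <-]; exists (fun i => a 0 i), (fun i => X 0 i).
by split => // i; have := a01 i; rewrite in_itv/= => /andP[].
Qed.

Lemma conv_hull_compact K : compact K -> compact (conv_hull K).
Proof.
move=> /(@convex_comb_compact _ m.+1); congr compact; apply/seteqP; split.
- exact: convex_comb_conv_hull.
- exact: conv_hull_convex_comb.
Qed.

End ConvexHull.

(** * Separation by a sphere *)

Section DotProduct.
Context {R : realType} {m : nat}.
Implicit Types u v w : 'rV[R]_m.

Definition dotp u v : R := (u *m v^T) 0 0.

Lemma dotpE u v : dotp u v = \sum_i u 0 i * v 0 i.
Proof. by rewrite /dotp mxE; apply: eq_bigr => i _; rewrite mxE. Qed.

Lemma dotpC u v : dotp u v = dotp v u.
Proof. by rewrite !dotpE; apply: eq_bigr => i _; rewrite mulrC. Qed.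

Lemma dotpDl u v w : dotp (u + v) w = dotp u w + dotp v w.
Proof. by rewrite /dotp mulmxDl mxE. Qed.

Lemma dotpZl (a : R) u w : dotp (a *: u) w = a * dotp u w.
Proof. by rewrite /dotp -scalemxAl mxE. Qed.

Lemma dotpNl u w : dotp (- u) w = - dotp u w.
Proof. by rewrite -scaleN1r dotpZl mulN1r. Qed.

Lemma dotpDr u v w : dotp w (u + v) = dotp w u + dotp w v.
Proof. by rewrite dotpC dotpDl !(dotpC w). Qed.

Lemma dotpZr (a : R) u w : dotp w (a *: u) = a * dotp w u.
Proof. by rewrite dotpC dotpZl (dotpC w). Qed.

Lemma dotpNr u w : dotp w (- u) = - dotp w u.
Proof. by rewrite dotpC dotpNl (dotpC w). Qed.

Definition dotp_linE := (dotpDl, dotpDr, dotpNl, dotpNr, dotpZl, dotpZr).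

Lemma dotp_ge0 u : 0 <= dotp u u.
Proof. by rewrite dotpE; apply: sumr_ge0 => i _; rewrite -expr2 sqr_ge0. Qed.

Lemma dotp_eq0 u : (dotp u u == 0) = (u == 0).
Proof.
apply/eqP/eqP => [|->]; last by rewrite /dotp mul0mx mxE.
rewrite dotpE => /psumr_eq0P uu; apply/rowP => i; rewrite mxE; apply/eqP.
by rewrite -sqrf_eq0 expr2 uu// => j _; rewrite -expr2 sqr_ge0.
Qed.

Lemma dotp_gt0 u : (0 < dotp u u) = (u != 0).
Proof. by rewrite lt_def dotp_ge0 andbT dotp_eq0. Qed.

Lemma dotp_continuous {T : topologicalType} (f g : T -> 'rV[R]_m) (x : T) :
  {for x, continuous f} -> {for x, continuous g} ->
  {for x, continuous (fun y => dotp (f y) (g y))}.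
Proof.
move=> cf cg; rewrite /prop_for (_ : (fun y => _) = fun y => \sum_i f y 0 i * g y 0 i).
  apply: continuous_sum => i; apply: continuousM.
    exact: (continuous_comp cf (@mx_entry_continuous _ _ _ _ _ _)).
  exact: (continuous_comp cg (@mx_entry_continuous _ _ _ _ _ _)).
by apply/funext => y; rewrite dotpE.
Qed.

(** The centre is found by moving from the point [c0] of the hull nearest to [q]
    far away in the direction [c0 - q]: large spheres around it are nearly flat,
    and approximate the hyperplane through [c0] that separates [q] from [K]. *)
Lemma sphere_separation (K : set 'rV[R]_m) (q : 'rV[R]_m) :
  compact K -> K !=set0 -> ~ conv_hull K q ->
  exists c, forall k, K k -> dotp (k - c) (k - c) < dotp (q - c) (q - c).
Proof.
move=> cK K0 qK.
have KC : K `<=` conv_hull K by exact: sub_gen_smallest.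
have cdist (p : 'rV[R]_m) : continuous (fun x : 'rV[R]_m => dotp (x - p) (x - p)).
  have cB : continuous (fun x : 'rV[R]_m => x - p).
    by move=> x; exact: (cvgB cvg_id (cvg_cst _)).
  by move=> x; exact: (dotp_continuous (cB x) (cB x)).
have [|c0 /set_mem Cc0 c0min] := @compact_EVT_min _ _
  (fun x : 'rV[R]_m => dotp (x - q) (x - q))
  _ _ (conv_hull_compact cK) (continuous_subspaceT (cdist q)).
  by have [k Kk] := K0; exists k; apply: KC.
have [kmax /set_mem Kkmax maxk] := @compact_EVT_max _ _
  (fun x : 'rV[R]_m => dotp (x - c0) (x - c0))
  _ K0 cK (continuous_subspaceT (cdist c0)).
set D := dotp (kmax - c0) _ in maxk.
have [u qu] : exists u, q = c0 + u by exists (q - c0); rewrite subrKC.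
have u0 : 0 < dotp u u.
  by rewrite dotp_gt0; apply/eqP => u0; apply: qK; rewrite qu u0 addr0.
(* Otherwise the hull would come closer to [q] along the segment to [c0 + d]. *)
have obtuse d : conv_hull K (c0 + d) -> dotp u d <= 0.
  move=> Cx; rewrite leNgt; apply/negP; have [a ad] : exists a, a = dotp u d by eexists.
  rewrite -ad => a0; have d0 := dotp_ge0 d.
  have s0 : 0 < a + dotp d d by rewrite ltr_wpDr.
  (* In [|t d - u|^2 = |u|^2 - 2 t a + t^2 |d|^2] the linear term then prevails. *)
  pose t := a / (a + dotp d d).
  have t0 : 0 < t by rewrite divr_gt0.
  have t1 : t <= 1 by rewrite ler_pdivrMr// mul1r lerDl.
  have : conv_hull K (t *: (c0 + d) + (1 - t) *: c0).
    apply: (@convex_comb_conv_hull _ _ _ (m.+1 + m.+1)).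
    by apply: convex_comb_conv => //; [exact: ltW | exact: conv_hull_convex_comb..].
  move=> /mem_set/c0min.
  have -> : t *: (c0 + d) + (1 - t) *: c0 - q = t *: d - u.
    by apply/rowP => i; rewrite qu !mxE; ring.
  have -> : c0 - q = - u by rewrite qu opprD addrA subrr add0r.
  rewrite !dotp_linE (dotpC d u) -ad.
  suff : t * (t * dotp d d) < t * (2 * a) by lra.
  rewrite ltr_pM2l// /t mulrAC ltr_pdivrMr//.
  nra.
(* With this [s], the gain [2 * s * dotp u u] of [q] exceeds the bound [D]. *)
pose s := (D + 1) / dotp u u.
have su : s * dotp u u = D + 1 by rewrite divfK// gt_eqF.
have D0 : 0 <= D by exact: dotp_ge0.
have s0 : 0 <= s by rewrite divr_ge0 ?ltW// ltr_wpDl.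
exists (c0 - s *: u) => k Kk.
have [d kd] : exists d, k = c0 + d by exists (k - c0); rewrite subrKC.
have shift x : c0 + x - (c0 - s *: u) = x + s *: u.
  by rewrite opprD opprK addrACA subrr add0r.
have ud : s * dotp u d <= 0.
  by apply: mulr_ge0_le0 => //; apply: obtuse; rewrite -kd; exact: KC.
have := maxk _ (mem_set Kk); rewrite kd qu !shift addrC addKr.
rewrite !dotp_linE (dotpC d u) su; lra.
Qed.

End DotProduct.

(** * Differentials and functions of class C^k *)

Section Differentials.
Context {R : realType}.

Lemma near_eq_diff {V W : normedModType R} (f g : V -> W) (x : V) :
  {near x, f =1 g} -> differentiable f x ->
  differentiable g x /\ 'd g x = 'd f x :> (V -> W).
Proof.
move=> fg df.
have gE : g \o shift x = cst (g x) + 'd f x +o_ 0 id.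
  apply/eqaddoP => e e0.
  have fg0 : \forall y \near 0, f (y + x) = g (y + x).
    by move: fg; rewrite (near_shift 0 x)/= subr0.
  have /eqaddoP/(_ e e0) df0 := diff_locally df.
  apply: filterS2 fg0 df0 => y /= fgy.
  by rewrite !fctE /= -(nbhs_singleton fg) fgy.
have dgE : 'd g x = 'd f x :> (V -> W).
  by apply: diff_unique gE; exact: diff_continuous.
split=> //; apply/diff_locallyP; rewrite dgE; split=> //.
exact: diff_continuous.
Qed.

Lemma diff_entry {V : normedModType R} {m : nat} (F : V -> 'rV[R]_m) (x v : V) j :
  differentiable F x ->
  differentiable (fun y => F y 0 j) x /\
  'd (fun y => F y 0 j) x v = ('d F x v) 0 j.
Proof.
move=> dF.
have [c cE] : exists c : {linear 'rV[R]_m -> R}, c = (fun u => u 0 j) :> (_ -> _).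
  have lin : linear (fun u : 'rV[R]_m => u 0 j : R) by move=> a u w; rewrite !mxE.
  pose H := GRing.isLinear.Build _ _ _ _ _ lin.
  by exists (HB.pack (fun u : 'rV[R]_m => u 0 j : R) H : {linear _ -> _}).
have cc : continuous c by rewrite cE; exact: coord_continuous.
have dc := linear_differentiable (F x) cc.
have -> : (fun y => F y 0 j) = c \o F by rewrite cE.
split; first exact: differentiable_comp.
by rewrite diff_comp//= diff_lin// cE.
Qed.

Lemma differentiable_row {V : normedModType R} {m : nat} (F : V -> 'rV[R]_m) (x : V) :
  (forall j, differentiable (fun y => F y 0 j) x) -> differentiable F x.
Proof.
move=> dF.
have -> : F = \sum_(j < m) (fun y => F y 0 j *: delta_mx 0 j).
  apply/funext => y; rewrite fct_sumE {1}[F y]row_sum_delta.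
  by [].
by apply: differentiable_sum => j; exact: differentiableZl.
Qed.

Lemma jacobianE {n m : nat} (F : 'rV[R]_n -> 'rV[R]_m) x i j :
  ('J F x) i j = ('d F x (delta_mx 0 i)) 0 j.
Proof. by rewrite mxE. Qed.

Lemma mul_jacobian {n m : nat} (F : 'rV[R]_n -> 'rV[R]_m) x v :
  v *m 'J F x = 'd F x v.
Proof. by rewrite mul_rV_lin1. Qed.

End Differentials.

Section SmoothFunctions.
Context {R : realType}.
Implicit Types V W : normedModType R.

Lemma C_on_sub V W k (U U' : set V) (f : V -> W) :
  U' `<=` U -> C_on k U f -> C_on k U' f.
Proof.
move=> sU; elim: k f => [|k IH] f /=; first by move=> cf x /sU; exact: cf.
by move=> [df cf]; split=> [x /sU|v]; [exact: df | exact: IH].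
Qed.

Lemma C_onW V W k (U : set V) (f : V -> W) : C_on k.+1 U f -> C_on k U f.
Proof.
elim: k f => [|k IH] f.
  by move=> [df _] x Ux; apply: differentiable_continuous; exact: df.
by move=> [df cf]; split=> // v; exact: IH.
Qed.

Lemma C_on_eq V W k (U : set V) (f g : V -> W) : open U ->
  (forall x, U x -> f x = g x) -> C_on k U f -> C_on k U g.
Proof.
move=> oU; elim: k f g => [|k IH] f g fg; have near_fg x : U x -> {near x, f =1 g}.
- by move=> Ux; apply: filterS fg _; exact: open_nbhs_nbhs.
- move=> /= cf x Ux; rewrite /prop_for /continuous_at -fg//.
  by apply: cvg_trans (cf x Ux); apply: near_eq_cvg; apply: near_fg.
- by move=> Ux; apply: filterS fg _; exact: open_nbhs_nbhs.
move=> [df cf]; have dE x Ux := near_eq_diff (near_fg x Ux) (df x Ux).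
split=> [x /dE[]//|v]; apply: IH (cf v) => x Ux.
by rewrite (dE x Ux).2.
Qed.

Lemma C_on_cst V W k (U : set V) (a : W) : C_on k U (fun=> a).
Proof.
elim: k a => [|k IH] a; first by move=> x _; exact: cvg_cst.
split=> [x _|v]; first exact: differentiable_cst.
rewrite (_ : (fun x => _) = fun=> 0); first exact: IH.
by apply/funext => x; rewrite diff_cst.
Qed.

Lemma C_onD V W k (U : set V) (f g : V -> W) : open U ->
  C_on k U f -> C_on k U g -> C_on k U (fun x => f x + g x).
Proof.
move=> oU; elim: k f g => [|k IH] f g.
  by move=> cf cg x Ux; apply: continuousD; [exact: cf | exact: cg].
move=> [df cf] [dg cg]; split=> [x Ux|v].
  by apply: differentiableD; [exact: df | exact: dg].
apply: (C_on_eq oU _ (IH _ _ (cf v) (cg v))) => x Ux.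
exact: (esym (congr1 (@^~ v) (diffD (df x Ux) (dg x Ux)))).
Qed.

Lemma C_onM V k (U : set V) (f g : V -> R) : open U ->
  C_on k U f -> C_on k U g -> C_on k U (fun x => f x * g x).
Proof.
move=> oU; elim: k f g => [|k IH] f g.
  by move=> cf cg x Ux; apply: continuousM; [exact: cf | exact: cg].
move=> Cf Cg; have [[df cf] [dg cg]] := (Cf, Cg); split=> [x Ux|v].
  by apply: differentiableM; [exact: df | exact: dg].
have := C_onD oU (IH _ _ (C_onW Cf) (cg v)) (IH _ _ (C_onW Cg) (cf v)).
apply: C_on_eq => // x Ux.
exact: (esym (congr1 (@^~ v) (diffM (df x Ux) (dg x Ux)))).
Qed.

Lemma C_on_sum V k (U : set V) (I : Type) (s : seq I) (F : I -> V -> R) :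
  open U -> (forall i, C_on k U (F i)) -> C_on k U (fun x => \sum_(i <- s) F i x).
Proof.
move=> oU CF; elim: s => [|i s IH].
  by apply: (C_on_eq oU _ (C_on_cst k U (0 : R))) => x _; rewrite big_nil.
by apply: (C_on_eq oU _ (C_onD oU (CF i) IH)) => x _; rewrite big_cons.
Qed.

Lemma C_on_prod V k (U : set V) (I : Type) (s : seq I) (F : I -> V -> R) :
  open U -> (forall i, C_on k U (F i)) -> C_on k U (fun x => \prod_(i <- s) F i x).
Proof.
move=> oU CF; elim: s => [|i s IH].
  by apply: (C_on_eq oU _ (C_on_cst k U (1 : R))) => x _; rewrite big_nil.
by apply: (C_on_eq oU _ (C_onM oU (CF i) IH)) => x _; rewrite big_cons.
Qed.

Lemma C_on_det V k (U : set V) m (A : V -> 'M[R]_m) : open U ->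
  (forall i j, C_on k U (fun x => A x i j)) -> C_on k U (fun x => \det (A x)).
Proof.
move=> oU CA; apply: C_on_sum => // s; apply: C_onM => //; first exact: C_on_cst.
by apply: C_on_prod => // i; exact: CA.
Qed.

(** One induction covers all exponents, because the derivative of a power
    involves the power with exponent [a - 1]. *)
Lemma C_on_powR V k (U : set V) (f : V -> R) (a : R) : open U ->
  (forall x, U x -> 0 < f x) -> C_on k U f -> C_on k U (fun x => f x `^ a).
Proof.
move=> oU f0; have dpow x b : U x -> is_derive (f x) 1 (fun y : R => y `^ b) (b * f x `^ (b - 1)).
  by move=> Ux; apply: is_derive1_powR; exact: f0.
have diffp x b (Ux : U x) : differentiable (fun y : R => y `^ b) (f x).
  by apply/derivable1_diffP; case: (dpow x b Ux).
elim: k a => [|k IH] a.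
  move=> cf x Ux; have := differentiable_continuous (diffp x a Ux).
  exact: (continuous_comp (cf x Ux)).
move=> Cf; have [df cf] := Cf; split=> [x Ux|v].
  exact: (differentiable_comp (df x Ux) (diffp x a Ux)).
have := C_onM oU (cf v) (C_onM oU (C_on_cst k U a) (IH (a - 1) (C_onW Cf))).
apply: C_on_eq => // x Ux.
rewrite [in RHS](diff_comp (df x Ux) (diffp x a Ux)) /=.
rewrite diff1E; last exact: diffp.
by rewrite derive1E (@derive_val _ _ _ _ _ _ _ (dpow x a Ux)).
Qed.

Lemma C_on_row V k (U : set V) m (F : V -> 'rV[R]_m) : open U ->
  C_on k U F <-> forall j, C_on k U (fun x => F x 0 j).
Proof.
move=> oU; elim: k F => [|k IH] F; split.
- move=> cF j x Ux.
  exact: (continuous_comp (cF x Ux) (@mx_entry_continuous _ _ _ 0 j _)).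
- move=> cF x Ux A [P FP PA]; rewrite nbhs_filterE /=.
  have : \forall y \near x, forall j, P 0 j (F y 0 j).
    by apply: filter_forall => j; exact: (cF j x Ux (P 0 j) (FP 0 j)).
  by apply: filterS => y Py; apply: PA => i j; rewrite ord1.
- move=> [dF cF] j; split=> [x Ux|v]; first exact: (diff_entry 0 j (dF x Ux)).1.
  have /IH/(_ j) := cF v; apply: C_on_eq => // x Ux.
  by rewrite (diff_entry v j (dF x Ux)).2.
move=> CF; have dF x : U x -> differentiable F x.
  by move=> Ux; apply: differentiable_row => j; exact: (CF j).1.
split=> // v; apply/IH => j; apply: C_on_eq ((CF j).2 v) => // x Ux.
by rewrite (diff_entry v j (dF x Ux)).2.
Qed.

(** The chain rule, expanded on the canonical basis, writes the differential of
    the composite as a sum of products of functions of class C^k, one factor of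
    which is again a composite. *)
Lemma C_on_comp V k (U : set V) m (U' : set 'rV[R]_m) (T : V -> 'rV[R]_m)
    (g : 'rV[R]_m -> R) : open U -> (forall x, U x -> U' (T x)) ->
  C_on k U T -> C_on k U' g -> C_on k U (g \o T).
Proof.
move=> oU TU; elim: k g => [|k IH] g.
  by move=> cT cg x Ux; apply: continuous_comp; [exact: cT | exact/cg/TU].
move=> CT [dg cg]; have [dT cT] := CT; split=> [x Ux|v].
  by apply: differentiable_comp; [exact: dT | exact/dg/TU].
have : C_on k U (fun x => \sum_j ('d T x v) 0 j * 'd g (T x) (delta_mx 0 j)).
  apply: C_on_sum => // j; apply: C_onM => //.
    by have /(C_on_row _ _ oU) := cT v; exact.
  exact: (IH _ (C_onW CT) (cg _)).
apply: C_on_eq => // x Ux.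
rewrite [in RHS](diff_comp (dT x Ux) (dg _ (TU x Ux))) /=.
rewrite [in RHS](row_sum_delta ('d T x v)) linear_sum; apply: eq_bigr => j _.
by rewrite linearZ.
Qed.

Lemma C_on_comp_row V k (U : set V) m (U' : set 'rV[R]_m) p (T : V -> 'rV[R]_m)
    (G : 'rV[R]_m -> 'rV[R]_p) : open U -> open U' ->
  (forall x, U x -> U' (T x)) -> C_on k U T -> C_on k U' G -> C_on k U (G \o T).
Proof.
move=> oU oU' TU CT /(C_on_row _ _ oU') CG; apply/(C_on_row _ _ oU) => j.
exact: (C_on_comp oU TU CT (CG j)).
Qed.

Lemma smooth_on_jacobian n m (U : set 'rV[R]_n) (F : 'rV[R]_n -> 'rV[R]_m) i j :
  open U -> smooth_on U F -> smooth_on U (fun x => ('J F x) i j).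
Proof.
move=> oU CF k; have [_ /(_ (delta_mx 0 i))/(C_on_row _ _ oU)/(_ j)] := CF k.+1.
by apply: C_on_eq => // x _; rewrite jacobianE.
Qed.

End SmoothFunctions.

(** * Extrema along lines and of the distance to a point *)

Section MaximaOfDistance.
Context {R : realType}.

Lemma is_derive_line {V W : normedModType R} (f : V -> W) (x v : V) (t : R) (l : W) :
  is_derive (x + t *: v) v f l -> is_derive t 1 (fun s : R => f (x + s *: v)) l.
Proof.
have qE : (fun h : R => h^-1 *: (((fun s : R => f (x + s *: v)) \o shift t) (h *: 1) -
      f (x + t *: v))) =
    (fun h : R => h^-1 *: ((f \o shift (x + t *: v)) (h *: v) - f (x + t *: v))).
  apply/funext => h; congr (_ *: (f _ - _)).
  by rewrite /= [h *: 1]mulr1 scalerDl addrCA.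
by move=> [df <-]; split; rewrite /derivable /derive qE.
Qed.

Lemma near_line {V : normedModType R} (x v : V) (P : set V) :
  (\forall y \near x, P y) -> \forall t \near (0 : R), P (x + t *: v).
Proof.
have cline : {for (0 : R), continuous (fun t : R => x + t *: v)}.
  by apply: continuousD; [exact: cvg_cst | apply: continuousZr_tmp; exact: cvg_id].
by move=> Px; move: cline; rewrite /prop_for /continuous_at /= scale0r addr0 => /(_ P Px).
Qed.

Lemma near0_itv (P : set R) : (\forall t \near (0 : R), P t) ->
  exists2 e : R, 0 < e & forall t, t \in `]-e, e[ -> P t.
Proof.
move=> /nbhs_ballP[e /= e0 eP]; exists e => // t.
by rewrite in_itv/= -ltr_norml => te; apply: eP; rewrite /ball/= sub0r normrN.
Qed.

Lemma first_derivative_at_max (g g' : R -> R) :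
  (\forall t \near (0 : R), is_derive (t : R) 1 g (g' t)) ->
  (\forall t \near 0, g t <= g 0) -> g' 0 = 0.
Proof.
move=> dg gmax.
have [e e0 eP] := near0_itv (filterI dg gmax).
have e00 : 0 \in `]-e, e[ by rewrite in_itv/= oppr_lt0 e0.
have [dg0 _] := eP _ e00.
have dmax : is_derive (0 : R) 1 g 0.
  apply: (derive1_at_max _ _ e00); first by rewrite ge0_cp ?ltW.
    by move=> t /eP[[]].
  by move=> t /eP[].
by rewrite -(@derive_val _ _ _ _ _ _ _ dg0) (@derive_val _ _ _ _ _ _ _ dmax).
Qed.

Lemma diff_local_min {V : normedModType R} (f : V -> R) (x v : V) :
  (\forall y \near x, differentiable f y) -> (\forall y \near x, f x <= f y) ->
  'd f x v = 0.
Proof.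
move=> df fmin; apply: oppr_inj; rewrite oppr0.
have dline : \forall t \near (0 : R), is_derive (t : R) 1
    (fun t : R => - f (x + t *: v)) (- 'd f (x + t *: v) v).
  have := near_line v df; apply: filterS => t dft.
  apply: is_deriveN; apply: (@is_derive_line V R f x v t).
  by rewrite -deriveE//; apply: derivableP; exact: diff_derivable.
have := first_derivative_at_max dline; rewrite scale0r addr0; apply.
by have := near_line v fmin; apply: filterS => t; rewrite lerN2.
Qed.

(** If the second derivative were positive, the first one would be positive just
    after [0], and the mean value theorem would give larger values of [g]. *)
Lemma second_derivative_at_max (g g' : R -> R) (l : R) :
  (\forall t \near (0 : R), is_derive (t : R) 1 g (g' t)) ->
  is_derive (0 : R) 1 g' l -> (\forall t \near 0, g t <= g 0) -> l <= 0.
Proof.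
move=> dg dg' gmax; rewrite leNgt; apply/negP => l0.
have [e e0 eP] := near0_itv (filterI dg gmax).
have g'0 : g' 0 = 0 := first_derivative_at_max dg gmax.
have [dg'0 dg'l] := dg'.
have : (fun h : R => h^-1 *: ((g' \o shift 0) (h *: 1) - g' 0)) @ 0^' --> l.
  by rewrite -dg'l; exact: dg'0.
move=> /cvgr_gt/(_ 0 l0); rewrite near_withinE => /nbhs_ballP[d /= d0 dP].
have g'pos t : 0 < t -> t < d -> 0 < g' t.
  move=> t0 td; have := dP t; rewrite /ball/= sub0r normrN gtr0_norm// => /(_ td).
  move=> /(_ (lt0r_neq0 t0)); rewrite g'0 subr0 addr0 [t *: 1]mulr1.
  by rewrite pmulr_rgt0// invr_gt0.
pose b := Num.min d e / 2.
have me0 : 0 < Num.min d e by rewrite lt_min d0 e0.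
have b0 : 0 < b by rewrite divr_gt0.
have bm : b < Num.min d e by rewrite ltr_pdivrMr// mulr_natr mulr2n ltrDl.
have [bd be] : b < d /\ b < e by apply/andP; rewrite -lt_min.
have itv_e (t : R) : 0 <= t -> t <= b -> t \in `]-e, e[.
  move=> t0 tb; rewrite in_itv/= (le_lt_trans tb be) andbT.
  by rewrite (lt_le_trans _ t0)// oppr_lt0.
have dgb (t : R) : t \in `]0, b[ -> is_derive t 1 g (g' t).
  by rewrite in_itv/= => /andP[/ltW t0 /ltW tb]; case: (eP t (itv_e t t0 tb)).
have cg : {within `[0, b], continuous g}.
  apply: derivable_within_continuous => t; rewrite in_itv/= => /andP[t0 tb].
  by case: (eP t (itv_e t t0 tb)) => -[].
have [c] := MVT b0 dgb cg; rewrite in_itv/= subr0 => /andP[c0 cb] gb.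
have [_ gb0] := eP b (itv_e b (ltW b0) (lexx b)).
have : 0 < g b - g 0 by rewrite gb mulr_gt0// g'pos// (lt_trans cb).
by rewrite subr_gt0 ltNge gb0.
Qed.

Lemma is_derive_dotp {V : normedModType R} {m : nat} (f g : V -> 'rV[R]_m) (x v : V)
    (a b : 'rV[R]_m) : differentiable f x -> differentiable g x ->
  'd f x v = a -> 'd g x v = b ->
  is_derive x v (fun y => dotp (f y) (g y)) (dotp a (g x) + dotp (f x) b).
Proof.
move=> df dg <- <-.
have -> : (fun y => dotp (f y) (g y)) =
    \sum_(i < m) ((fun y => f y 0 i) * (fun y => g y 0 i)).
  by apply/funext => y; rewrite dotpE fct_sumE.
have -> : dotp ('d f x v) (g x) + dotp (f x) ('d g x v) =
    \sum_(i < m) (f x 0 i *: 'd g x v 0 i + g x 0 i *: 'd f x v 0 i).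
  rewrite !dotpE -big_split /=; apply: eq_bigr => i _.
  by rewrite addrC [X in _ = _ + X]mulrC.
apply: is_derive_sum => i.
have coord (h : V -> 'rV[R]_m) : differentiable h x ->
    is_derive x v (fun y => h y 0 i) ('d h x v 0 i).
  move=> dh; have [dhi <-] := diff_entry v i dh.
  by rewrite -(deriveE v dhi); apply: derivableP; exact: diff_derivable.
by apply: is_deriveM; exact: coord.
Qed.

Section LocalMaximum.
Context {n m : nat} (F : 'rV[R]_n -> 'rV[R]_m) (U : set 'rV[R]_n)
  (x : 'rV[R]_n) (c : 'rV[R]_m).
Hypothesis U_open : open U.
Hypothesis Ux : U x.
Hypothesis F_C2 : C_on 2 U F.
Hypothesis x_max : \forall y \near x,
  dotp (F y - c) (F y - c) <= dotp (F x - c) (F x - c).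

Let dF y : U y -> differentiable F y. Proof. exact: F_C2.1. Qed.

Let dFc y : U y ->
  differentiable (fun y => F y - c) y /\
  forall v, 'd (fun y => F y - c) y v = 'd F y v.
Proof.
move=> Uy; have dc : differentiable (cst (- c) : 'rV[R]_n -> 'rV[R]_m) y.
  exact: differentiable_cst.
split; first exact: (differentiableD (dF Uy) dc).
move=> v; have c0 : 'd (cst (- c) : 'rV[R]_n -> 'rV[R]_m) y v = 0.
  exact: (congr1 (@^~ v) (diff_cst (- c) y)).
have sum_diff : 'd (fun y => F y - c) y v =
    'd F y v + 'd (cst (- c) : 'rV[R]_n -> 'rV[R]_m) y v.
  exact: (congr1 (@^~ v) (diffD (dF Uy) dc)).
exact: (etrans sum_diff (etrans (congr1 (+%R ('d F y v)) c0) (addr0 _))).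
Qed.

Let dist_line (v : 'rV[R]_n) : \forall t \near (0 : R), is_derive (t : R) 1
  (fun t : R => dotp (F (x + t *: v) - c) (F (x + t *: v) - c))
  (2 * dotp (F (x + t *: v) - c) ('d F (x + t *: v) v)).
Proof.
have Un : \forall y \near x, U y by exact: open_nbhs_nbhs.
apply: filterS (near_line v Un) => t Ut.
apply: (@is_derive_line _ _ (fun y => dotp (F y - c) (F y - c))).
have [dG dGE] := dFc Ut.
have := is_derive_dotp dG dG (dGE v) (dGE v).
by rewrite (dotpC ('d F _ _)) mulr_natl mulr2n.
Qed.

Let line_max (v : 'rV[R]_n) : \forall t \near (0 : R),
  dotp (F (x + t *: v) - c) (F (x + t *: v) - c) <=
  dotp (F (x + 0 *: v) - c) (F (x + 0 *: v) - c).
Proof. by rewrite scale0r addr0; exact: (near_line v x_max). Qed.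

Lemma position_normal_at_max v : dotp (F x - c) ('d F x v) = 0.
Proof.
have /eqP := first_derivative_at_max (dist_line v) (line_max v).
by rewrite scale0r addr0 mulf_eq0 pnatr_eq0/= => /eqP.
Qed.

(** As [N] is orthogonal to the image of the differential, the first derivative
    of the squared distance does not change when [r *: N] is added to [F - c];
    since this makes its left factor vanish at [x], its derivative involves no
    second derivative of [F]. *)
Lemma second_order_at_max (N : 'rV[R]_n -> 'rV[R]_m) (r : R) v a b :
  differentiable N x -> 'd F x v = a -> 'd N x v = b ->
  (forall y, U y -> dotp (N y) ('d F y v) = 0) ->
  F x - c + r *: N x = 0 ->
  dotp a a + r * dotp b a <= 0.
Proof.
move=> dN <- <- Nperp xN.
have [dG dGE] := dFc Ux.
pose H := (fun y => F y - c) + r \*: N.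
have dH : differentiable H x.
  by apply: differentiableD => //; exact: differentiableZ.
have dHE : 'd H x v = 'd F x v + r *: 'd N x v.
  have sum_diff : 'd H x v = 'd (fun y => F y - c) x v + 'd (r \*: N) x v.
    exact: (congr1 (@^~ v) (diffD dG (differentiableZ r dN))).
  have sdiff : 'd (r \*: N) x v = r *: 'd N x v.
    exact: (congr1 (@^~ v) (diffZ r dN)).
  exact: (etrans sum_diff (congr2 +%R (dGE v) sdiff)).
have H0 : H x = 0 := xN.
have near_U : \forall y \near x, U y by exact: open_nbhs_nbhs.
have dd : is_derive x v (fun y => dotp (F y - c) ('d F y v))
    (dotp ('d F x v) ('d F x v) + r * dotp ('d N x v) ('d F x v)).
  have := is_derive_dotp dH ((F_C2.2 v).1 x Ux) dHE erefl.
  rewrite H0 [dotp 0 _]/dotp mul0mx mxE addr0 dotpDl dotpZl.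
  apply: near_eq_is_derive; apply: filterS near_U => y Uy.
  rewrite /H; have -> : ((fun y => F y - c) + r \*: N) y = F y - c + r *: N y by [].
  by rewrite dotpDl dotpZl Nperp// mulr0 addr0.
have dg' : is_derive (0 : R) 1
    (fun t : R => 2 * dotp (F (x + t *: v) - c) ('d F (x + t *: v) v))
    (2 * (dotp ('d F x v) ('d F x v) + r * dotp ('d N x v) ('d F x v))).
  apply: is_deriveZ.
  apply: (@is_derive_line _ _ (fun y => dotp (F y - c) ('d F y v))).
  by rewrite scale0r addr0.
have := second_derivative_at_max (dist_line v) dg' (line_max v).
by rewrite pmulr_rle0.
Qed.
End LocalMaximum.

End MaximaOfDistance.

(** * Charts and invariance of the boundary *)

Section Charts.
Context {R : realType} {n : nat} {M : manifold R n}.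
Implicit Types (c : chart R n M) (p : M).

Lemma half_space_near_interior (x : 'rV[R]_n) :
  half_space x -> ~ half_space_edge x ->
  \forall y \near x, half_space y /\ ~ half_space_edge y.
Proof.
move=> hx ex.
have : \forall y \near x, forall i : 'I_n, i = 0%N :> nat -> 0 < (y : 'rV[R]_n) 0 i.
  suff xi : forall i : 'I_n, \forall y \near x, i = 0%N :> nat -> 0 < (y : 'rV[R]_n) 0 i.
    exact: (@filter_forall _ _ _ _ (nbhs_filter x) xi).
  move=> i; have [i0|i0] := eqVneq (i : nat) 0%N; last first.
    by apply: (@filterE _ (nbhs x) (nbhs_filter x)) => y iy; move: i0; rewrite iy eqxx.
  have xi : 0 < x 0 i.
    by rewrite lt_def hx// andbT; apply/eqP => xi; apply: ex; exists i.
  have := @coord_continuous R 1 n 0 i x => /cvgr_gt/(_ 0 xi).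
  by apply: filterS => y yi _.
apply: filterS => y yP; split; first by move=> i /yP/ltW.
by move=> [i [/yP]] + y0; rewrite y0 ltxx.
Qed.

Lemma chart_half_space c p : cdom c p -> half_space (cmap c p).
Proof.
move=> cp; have [W _ cW] := cmap_image c.
by have [] : (W `&` half_space) (cmap c p) by rewrite -cW; exists p.
Qed.

Lemma chart_near c p (P : set 'rV[R]_n) : cdom c p ->
  (\forall y \near cmap c p, P y) -> \forall q \near p, cdom c q /\ P (cmap c q).
Proof.
move=> cp Px; apply: filterI.
  by apply: open_nbhs_nbhs; split=> //; exact: cdom_open.
have := @cmap_continuous _ _ _ c; rewrite continuous_open_subspace; last exact: cdom_open.
by move=> /(_ p (mem_set cp)) /(_ P Px).
Qed.

Lemma chart_inv_near c p (P : set M) : cdom c p -> (\forall q \near p, P q) ->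
  \forall y \near cmap c p, (cmap c @` cdom c) y -> P (cinv c y).
Proof.
move=> cp Pp; have im : (cmap c @` cdom c) (cmap c p) by exists p.
have {}Pp : nbhs (cinv c (cmap c p)) P by rewrite cmapK.
by have /subspace_continuousP/(_ _ im P Pp) := @cinv_continuous _ _ _ c.
Qed.

Lemma chart_image_interior c p : cdom c p -> ~ half_space_edge (cmap c p) ->
  \forall y \near cmap c p, (cmap c @` cdom c) y /\ ~ half_space_edge y.
Proof.
move=> cp ep; have [W oW cW] := cmap_image c.
have Wp : W (cmap c p).
  by have [] : (W `&` half_space) (cmap c p) by rewrite -cW; exists p.
have := half_space_near_interior (chart_half_space cp) ep.
have : \forall y \near cmap c p, W y by exact: open_nbhs_nbhs.
by apply: filterS2 => y Wy [hy ey]; split=> //; rewrite cW.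
Qed.

Lemma smooth_extension_shrink {V W : normedModType R} (S : set V) (g : V -> W)
    (x : V) (G : V -> W) (P : set V) :
  smooth_extension S g x G -> (\forall y \near x, P y) ->
  exists U, [/\ open_nbhs x U, smooth_on U G, U `<=` P &
    forall y, U y -> S y -> G y = g y].
Proof.
move=> [U [[oU Ux] GU Gg]] Px.
exists (U `&` P°); split.
- by split; [apply: openI => //; exact: open_interior | split].
- by move=> k; apply: C_on_sub (GU k); exact: subIsetl.
- by move=> y [_ /interior_subset].
- by move=> y [Uy _]; exact: Gg.
Qed.

(** Shrinking the domain of the smooth extension removes the condition that the
    point lie in the image of the overlap of the two charts. *)
Lemma transition c1 c2 p : atlas c1 -> atlas c2 -> cdom c1 p -> cdom c2 p ->
  exists T U, [/\ open_nbhs (cmap c1 p) U, smooth_on U T, T (cmap c1 p) = cmap c2 p &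
    forall y, U y -> (cmap c1 @` cdom c1) y ->
      cdom c2 (cinv c1 y) /\ T y = cmap c2 (cinv c1 y)].
Proof.
move=> a1 a2 c1p c2p; have [T /smooth_extension_shrink] := atlas_compatible a1 a2 c1p c2p.
have near_c2 : \forall q \near p, cdom c2 q.
  by apply: open_nbhs_nbhs; split=> //; exact: cdom_open.
move=> /(_ _ (chart_inv_near c1p near_c2))[U [xU TU Uc2 TE]].
have TE' y : U y -> (cmap c1 @` cdom c1) y ->
    cdom c2 (cinv c1 y) /\ T y = cmap c2 (cinv c1 y).
  move=> Uy im; have c2y := Uc2 y Uy im; split=> //; apply: TE => //.
  by case: im c2y => q c1q <-; rewrite cmapK// => c2q; exists q.
exists T, U; split=> //.
have [|_ ->] := TE' (cmap c1 p) xU.2; first by exists p.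
by rewrite cmapK.
Qed.

Lemma smooth_on_continuous {V W : normedModType R} (U : set V) (G : V -> W) x :
  open_nbhs x U -> smooth_on U G -> {for x, continuous G}.
Proof. by move=> [_ Ux] /(_ 0%N); exact. Qed.

Lemma smooth_on_differentiable {V W : normedModType R} (U : set V) (G : V -> W) x :
  U x -> smooth_on U G -> differentiable G x.
Proof. by move=> Ux /(_ 1%N)[dG _]; exact: dG. Qed.

(** If [c1] sent [p] to an interior point, the transition map from [c1] to [c2]
    would be defined on a full neighbourhood of that point, with values in the
    half-space; its first component, minimal there, would have a vanishing
    differential, against the invertibility of transition maps. *)
Lemma boundary_invariance c1 c2 p : atlas c1 -> atlas c2 ->
  cdom c1 p -> cdom c2 p ->
  half_space_edge (cmap c2 p) -> half_space_edge (cmap c1 p).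
Proof.
move=> a1 a2 c1p c2p e2; apply: contrapT => e1.
have [S [US [xUS SU Sp SE]]] := transition a1 a2 c1p c2p.
have [T [UT [xUT TU Tp TE]]] := transition a2 a1 c2p c1p.
have near_US : \forall z \near cmap c1 p, US z by exact: open_nbhs_nbhs.
have Sval : \forall z \near cmap c1 p, half_space (S z) /\ T (S z) = z.
  have Snear : \forall z \near cmap c1 p, UT (S z).
    have nUT : nbhs (S (cmap c1 p)) UT by rewrite Sp; exact: open_nbhs_nbhs.
    exact: (smooth_on_continuous xUS SU nUT).
  move: (chart_image_interior c1p e1) near_US Snear.
  apply: filterS3 => z [im _] Uz UTz.
  have [c2z Sz] := SE z Uz im; rewrite Sz; split; first exact: chart_half_space.
  have [|_] := TE (S z) UTz; first by rewrite Sz; exists (cinv c1 z).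
  rewrite Sz cmapK// => ->; case: im => q c1q <-; by rewrite cmapK.
have dS : differentiable S (cmap c1 p) := smooth_on_differentiable xUS.2 SU.
have dT : differentiable T (S (cmap c1 p)).
  by rewrite Sp; exact: smooth_on_differentiable xUT.2 TU.
have TS v : 'd T (S (cmap c1 p)) ('d S (cmap c1 p) v) = v.
  have near_id : {near cmap c1 p, T \o S =1 id}.
    by apply: filterS Sval => z [].
  have [_ dE] := near_eq_diff near_id (differentiable_comp dS dT).
  have d1 := congr1 (@^~ v) (diff_comp dS dT).
  have d2 := congr1 (@^~ v) dE.
  have d3 : 'd (@id 'rV[R]_n) (cmap c1 p) v = v.
    exact: (congr1 (@^~ v) (@diff_val _ _ _ _ _ _ _ (is_diff_id (cmap c1 p)))).
  exact: (etrans (esym d1) (etrans (esym d2) d3)).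
have [i [i0 xi]] := e2.
have Si v : 'd S (cmap c1 p) v 0 i = 0.
  have [_ <-] := diff_entry v i dS; apply: diff_local_min.
    apply: filterS near_US => z Uz.
    by have [] := diff_entry v i (smooth_on_differentiable Uz SU).
  by apply: filterS Sval => z [+ _]; rewrite Sp xi; exact.
(* [JS *m JT = 1] makes [JS] invertible, but its column [i] vanishes. *)
have JST : 'J S (cmap c1 p) *m 'J T (S (cmap c1 p)) = 1%:M.
  apply/row_matrixP => j; rewrite row_mul rowE mul_jacobian mul_jacobian.
  by rewrite TS row1.
have := mulmx1C JST => /(congr1 (mulmx (delta_mx 0 i : 'rV[R]_n))).
rewrite mulmxA mul_jacobian mulmx1 => /(congr1 (fun u : 'rV[R]_n => u 0 i)).
rewrite Si mxE !eqxx => /esym/eqP.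
by rewrite oner_eq0.
Qed.

Lemma boundaryE c p : atlas c -> cdom c p -> boundary M p <-> half_space_edge (cmap c p).
Proof.
move=> ac cp; split=> [[c' [ac' c'p]]|ep]; last by exists c.
exact: boundary_invariance.
Qed.

Lemma closed_boundary : closed (boundary M).
Proof.
rewrite -[boundary M]setCK; apply: open_closedC; rewrite openE => p bp.
have [c ac cp] := atlas_cover p.
have /(chart_image_interior cp) : ~ half_space_edge (cmap c p) by move/(boundaryE ac cp).
move=> /(chart_near cp); apply: filterS => q [cq [_ eq]].
by move/(boundaryE ac cq).
Qed.

Lemma immersion_continuous m (f : M -> 'rV[R]_m) : immersion f -> continuous f.
Proof.
move=> fi p; have [c ac cp] := atlas_cover p.
have [_ [F [U [xU FU FE]] _] _] := fi c p ac cp.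
have near_eq : \forall q \near p, F (cmap c q) = f q.
  have := chart_near cp (open_nbhs_nbhs xU).
  apply: filterS => q [cq Uq]; rewrite FE//=; first by rewrite cmapK.
  by exists q.
have cF : F (cmap c q) @[q --> p] --> F (cmap c p).
  move=> A FA; have := chart_near cp (smooth_on_continuous xU FU FA).
  by apply: filterS => q [].
rewrite /continuous_at -(nbhs_singleton near_eq).
by apply: cvg_trans cF; exact: near_eq_cvg.
Qed.

End Charts.

(** * A unit normal field *)

Section NormalField.
Context {R : realType} {n : nat}.
Implicit Types (w : 'rV[R]_n.+1) (J : 'M[R]_(n, n.+1)).

Definition frame w J : 'M[R]_(1 + n) := col_mx (w : 'M[R]_(1, 1 + n)) J.

(** The generalised cross product of the rows of [J]. Cofactors along the first
    row of the frame depend on [J] only, so that [0] stands for an arbitrary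
    first row. *)
Definition cross J : 'rV[R]_n.+1 := \row_j cofactor (frame 0 J) 0 j.

Lemma frame_lift w J (i : 'I_n) j : frame w J (lift ord0 i) j = J i j.
Proof.
rewrite /frame (_ : lift ord0 i = rshift 1 i); first exact: col_mxEd.
exact: val_inj.
Qed.

Lemma cofactor_frame w J j : cofactor (frame w J) 0 j = cross J 0 j.
Proof.
rewrite mxE /cofactor; congr (_ * \det _); apply/matrixP => i k.
by rewrite mxE [LHS]mxE [RHS]mxE [RHS]mxE !frame_lift.
Qed.

(** This is the product of a matrix with the first column of its adjugate. *)
Lemma frame_cross w J : frame w J *m (cross J)^T = \det (frame w J) *: delta_mx 0 0.
Proof.
have -> : (cross J)^T = col 0 (\adj (frame w J)).
  by apply/colP => j; rewrite mxE -(cofactor_frame w) [RHS]mxE [RHS]mxE.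
by rewrite colE mulmxA mul_mx_adj mul_scalar_mx.
Qed.

Lemma cross_perp J : J *m (cross J)^T = 0.
Proof.
have := frame_cross 0 J; rewrite /frame mul_col_mx => /(congr1 dsubmx).
rewrite col_mxKd => ->; apply/matrixP => i j; rewrite !mxE.
by rewrite (_ : rshift 1 i == 0 = false) ?mulr0.
Qed.

Lemma frame_unit w J : w != 0 -> J *m w^T = 0 -> row_free J -> frame w J \in unitmx.
Proof.
move=> w0 Jw Jfree; rewrite -row_free_unit -kermx_eq0; apply/rowV0P => v.
move=> /sub_kermxP; rewrite -[v]hsubmxK /frame mul_row_col => vB.
have a0 : lsubmx v = 0.
  have [a aE] : exists a, lsubmx v = a%:M by eexists; exact: mx11_scalar.
  have := congr1 (fun u : 'rV_ _ => dotp u w) vB.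
  rewrite dotpDl {2}/dotp -mulmxA Jw mulmx0 mxE addr0.
  rewrite aE mul_scalar_mx dotpZl [RHS]/dotp mul0mx [RHS]mxE => /eqP.
  by rewrite mulf_eq0 dotp_eq0 (negbTE w0) orbF => /eqP ->; rewrite raddf0.
move: vB; rewrite a0 mul0mx add0r => vJ.
have -> : rsubmx v = 0 by apply: (row_free_inj Jfree); rewrite vJ mul0mx.
exact: row_mx0.
Qed.

(** The frame is invertible, so [B] is a combination of [w] and the rows of [J],
    and multiplying by [w^T] shows that [w] has coefficient [0]. Applied to the
    derivatives of a unit normal field, this yields the shape operator. *)
Lemma perp_rowspan w J (B : 'M[R]_(n, n.+1)) :
  w != 0 -> J *m w^T = 0 -> row_free J -> B *m w^T = 0 -> exists A, A *m J = B.
Proof.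
move=> w0 Jw Jfree Bw; have Bu := frame_unit w0 Jw Jfree.
pose C := B *m invmx (frame w J).
have CB : C *m frame w J = B by rewrite mulmxKV.
exists (rsubmx C).
move: CB; rewrite -[C in LHS]hsubmxK /frame mul_row_col => CB.
suff C0 : lsubmx C = 0 by rewrite -CB C0 mul0mx add0r.
have := congr1 (mulmx^~ w^T) CB.
rewrite mulmxDl -!mulmxA Jw mulmx0 addr0 Bw.
rewrite [w *m _]mx11_scalar mul_mx_scalar => /eqP.
by rewrite scalemx_eq0 -[_ 0 0]/(dotp w w) dotp_eq0 (negbTE w0) => /eqP.
Qed.

(** The transposes of [w] and [cross J] are both sent by the invertible frame to
    multiples of the first basis vector. *)
Lemma cross_collinear w J : w != 0 -> J *m w^T = 0 -> row_free J ->
  exists2 a, a != 0 & cross J = a *: w.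
Proof.
move=> w0 Jw Jfree; have Bu := frame_unit w0 Jw Jfree.
have ww : dotp w w != 0 by rewrite dotp_eq0.
exists (\det (frame w J) / dotp w w).
  by rewrite mulf_neq0 ?invr_eq0 // -unitfE -unitmxE.
apply: trmx_inj; rewrite linearZ /=.
have Bw : frame w J *m w^T = dotp w w *: delta_mx 0 0.
  rewrite /frame mul_col_mx Jw; apply/colP => i; rewrite !mxE.
  case: splitP => j ij; last by rewrite !mxE -val_eqE /= ij mulr0.
  rewrite !ord1 (_ : i = 0) ?eqxx ?mulr1//; apply: val_inj; rewrite /= ij.
  by rewrite ord1.
rewrite -[LHS](mulKmx Bu) frame_cross -scalerA -[w^T in RHS](mulKmx Bu) Bw.
by rewrite -!scalemxAr; congr (_ *: _); rewrite scalerA mulVf// scale1r.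
Qed.

Lemma cross_smooth (U : set 'rV[R]_n) (F : 'rV[R]_n -> 'rV[R]_n.+1) :
  open U -> smooth_on U F -> smooth_on U (fun y => cross ('J F y)).
Proof.
move=> oU FU k; apply/(C_on_row _ _ oU) => j.
have : C_on k U (fun y => cofactor (frame 0 ('J F y)) 0 j).
  apply: C_onM => //; first exact: C_on_cst.
  apply: C_on_det => // i l.
  have := @smooth_on_jacobian _ _ _ _ _ i (lift j l) oU FU k.
  by apply: C_on_eq => // y _; rewrite [RHS]mxE [RHS]mxE frame_lift.
by apply: C_on_eq => // y _; rewrite [RHS]mxE.
Qed.

(** The field is the normalised cross product of the rows of the Jacobian. At
    [x] the cross product is collinear with [w]; its sign is chosen to make it
    point to the side opposite to [w]. *)
Lemma normal_field (U : set 'rV[R]_n) (F : 'rV[R]_n -> 'rV[R]_n.+1) x w :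
  open_nbhs x U -> smooth_on U F -> row_free ('J F x) ->
  w != 0 -> 'J F x *m w^T = 0 ->
  exists N U' r, [/\ open_nbhs x U', U' `<=` U, smooth_on U' N,
    forall y, U' y -> dotp (N y) (N y) = 1 /\ 'J F y *m (N y)^T = 0 &
    0 < r /\ w + r *: N x = 0].
Proof.
move=> [oU Ux] FU Jfree w0 Jw.
pose nu y := cross ('J F y).
have nuU : smooth_on U nu by exact: cross_smooth.
have [a a0 nux] : exists2 a, a != 0 & nu x = a *: w by exact: cross_collinear.
have nux0 : nu x != 0 by rewrite nux scaler_eq0 negb_or a0.
pose U' := U `&` [set y | 0 < dotp (nu y) (nu y)].
have sq_cont y : U y -> {for y, continuous (fun y => dotp (nu y) (nu y))}.
  by move=> Uy; apply: dotp_continuous; exact: (nuU 0%N).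
have oU' : open U'.
  rewrite openE => y [Uy nuy]; apply: filterI; first exact: open_nbhs_nbhs.
  by have /cvgr_gt/(_ 0 nuy) := sq_cont y Uy.
have sU' : U' `<=` U by exact: subIsetl.
have nuU' k : C_on k U' nu by exact: C_on_sub (nuU k).
pose rho y := dotp (nu y) (nu y) `^ (- 2^-1).
have rhoU' k : C_on k U' rho.
  apply: C_on_powR => // [y []//|].
  apply: (@C_on_eq _ _ _ _ _ (fun y => \sum_i nu y 0 i * nu y 0 i)) => //.
    by move=> y _; rewrite dotpE.
  by apply: C_on_sum => // i; apply: C_onM => //; apply: (C_on_row _ _ oU').1.
have rho2 y : U' y -> rho y * rho y * dotp (nu y) (nu y) = 1.
  move=> [_ nuy]; rewrite /rho -powRD; last by rewrite (gt_eqF nuy) implybT.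
  rewrite (_ : - 2^-1 + - 2^-1 = -1 :> R); last by lra.
  by rewrite powR_inv1 ?ltW// mulVf// gt_eqF.
have U'x : U' x by split=> //=; rewrite dotp_gt0.
have rhox : 0 < rho x by rewrite powR_gt0// dotp_gt0.
pose s := - Num.sg a.
have s2 : s * s = 1 by rewrite mulrNN -expr2 sqr_sg a0.
exists (fun y => (s * rho y) *: nu y), U', (rho x * `|a|)^-1; split => //.
- move=> k; apply/(C_on_row _ _ oU') => j.
  apply: (@C_on_eq _ _ _ _ _ (fun y => (s * rho y) * nu y 0 j)) => //.
    by move=> y _; rewrite [RHS]mxE.
  apply: C_onM => //; first by apply: C_onM => //; exact: C_on_cst.
  exact: (C_on_row _ _ oU').1.
- move=> y U'y; split.
    rewrite dotpZl dotpZr -(rho2 y U'y) -[RHS]mul1r -s2; ring.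
  by rewrite linearZ /= -scalemxAr cross_perp scaler0.
have ra : 0 < rho x * `|a| by rewrite mulr_gt0// normr_gt0.
split; first by rewrite invr_gt0.
have coef : s * rho x * a = - (rho x * `|a|) by rewrite normrEsg /s; ring.
by rewrite nux !scalerA -mulrA coef mulrN mulVf ?gt_eqF// scaleN1r subrr.
Qed.

End NormalField.

(** * The farthest point is elliptic *)

Section Ellipticity.
Context {R : realType} {n : nat} {M : manifold R n}.
Variables (f : M -> 'rV[R]_n.+1) (p : M) (c : chart R n M).
Hypotheses (ac : atlas c) (cp : cdom c p).
Hypothesis p_int : ~ boundary M p.

(** A normal field built in the chart [c] is normal and smooth in every other
    chart, by composition with the transition map; near an interior point
    that map and its differential are defined on full neighbourhoods. *)
Lemma unit_normal_near_chart (U : set 'rV[R]_n) (F N : 'rV[R]_n -> 'rV[R]_n.+1) :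
  open_nbhs (cmap c p) U -> smooth_on U F -> smooth_on U N ->
  (forall y, U y -> (cmap c @` cdom c) y -> F y = f (cinv c y)) ->
  (forall y, U y -> dotp (N y) (N y) = 1 /\ 'J F y *m (N y)^T = 0) ->
  unit_normal_near f (N \o cmap c) p.
Proof.
move=> xU FU NU FE NE.
have near_int : \forall q \near p, ~ boundary M q.
  have := closed_openC (@closed_boundary _ _ M); rewrite openE.
  by move=> /(_ p p_int).
have near_U := chart_near cp (open_nbhs_nbhs xU).
move: near_U near_int; apply: filterS2 => q [cq Uq] bq.
have trans c2 : atlas c2 -> cdom c2 q -> exists T U2,
    [/\ open_nbhs (cmap c2 q) U2, smooth_on U2 T, T (cmap c2 q) = cmap c q,
        forall y, U2 y -> U (T y) &
        forall y, U2 y -> (cmap c2 @` cdom c2) y ->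
          cdom c (cinv c2 y) /\ T y = cmap c (cinv c2 y)].
  move=> a2 c2q; have [T [U2 [[oU2 xU2] TU Tq TE]]] := transition a2 ac c2q cq.
  have TUn : \forall y \near cmap c2 q, U (T y).
    have nU : nbhs (T (cmap c2 q)) U.
      by rewrite Tq; apply: open_nbhs_nbhs; split=> //; exact: xU.1.
    exact: (smooth_on_continuous (conj oU2 xU2) TU nU).
  exists T, (U2 `&` [set y | U (T y)]°); split=> //.
  - split; last by split.
    by apply: openI => //; exact: open_interior.
  - by move=> k; apply: C_on_sub (TU k); exact: subIsetl.
  - by move=> y [_ /interior_subset].
  - by move=> y [Uy _]; exact: TE.
split.
- move=> c2 a2 c2q; have [T [U2 [xU2 TU Tq TUU TE]]] := trans c2 a2 c2q.
  exists (N \o T), U2; split=> //.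
    by move=> k; apply: (C_on_comp_row xU2.1 xU.1 TUU (TU k) (NU k)).
  by move=> y U2y im; have [_ /= ->] := TE y U2y im.
- apply/matrixP => i j; rewrite !ord1 [RHS]mxE eqxx mulr1n.
  exact: (NE _ Uq).1.
- move=> c2 J a2 c2q [G [V [xV GV GE]] ->].
  have [T [U2 [xU2 TU Tq TUU TE]]] := trans c2 a2 c2q.
  have e2 : ~ half_space_edge (cmap c2 q) by move/(boundaryE a2 c2q).
  have FT_G : {near cmap c2 q, F \o T =1 G}.
    move: (chart_image_interior c2q e2) (open_nbhs_nbhs xU2) (open_nbhs_nbhs xV).
    apply: filterS3 => y [im _] U2y Vy.
    have [cy Ty] := TE y U2y im; rewrite GE//= FE; last 2 first.
    + exact: TUU.
    + by rewrite Ty; exists (cinv c2 y).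
    + by rewrite Ty cmapK.
  have dT := smooth_on_differentiable xU2.2 TU.
  have dF : differentiable F (T (cmap c2 q)).
    by rewrite Tq; exact: smooth_on_differentiable Uq FU.
  have JG : 'J G (cmap c2 q) = 'J T (cmap c2 q) *m 'J F (cmap c q).
    apply/row_matrixP => i; rewrite row_mul !rowE -Tq !mul_jacobian.
    have [_ dE] := near_eq_diff FT_G (differentiable_comp dT dF).
    have d1 := congr1 (@^~ (delta_mx 0 i)) (diff_comp dT dF).
    exact: (etrans (congr1 (@^~ (delta_mx 0 i)) dE) d1).
  by rewrite JG -mulmxA /= (NE _ Uq).2 mulmx0.
Qed.

(** The image touches from inside the sphere centred at [o] through [f p], so its
    principal curvatures with respect to the inner normal are at least the
    inverse of the radius. *)
Lemma farthest_point_elliptic (o : 'rV[R]_n.+1) : immersion f ->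
  f p != o -> (forall q, dotp (f q - o) (f q - o) <= dotp (f p - o) (f p - o)) ->
  elliptic f p.
Proof.
move=> fi fpo pmax; have [_ [F Fext ->] Jfree] := fi c p ac cp.
have ep : ~ half_space_edge (cmap c p) by move/(boundaryE ac cp).
have [U [xU FU Uim FE]] := smooth_extension_shrink Fext (chart_image_interior cp ep).
have {Uim} Uim y : U y -> (cmap c @` cdom c) y by move=> /Uim[].
set x := cmap c p in xU Jfree *.
have [oU Ux] := xU.
have Fx : F x = f p by rewrite (FE _ Ux (Uim _ Ux)) /= cmapK.
have Fmax : \forall y \near x, dotp (F y - o) (F y - o) <= dotp (F x - o) (F x - o).
  have := open_nbhs_nbhs xU; apply: filterS => y Uy.
  rewrite Fx (FE _ Uy (Uim _ Uy)); exact: pmax.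
pose w := F x - o.
have w0 : w != 0 by rewrite /w Fx subr_eq0.
have Jw : 'J F x *m w^T = 0.
  apply/matrixP => i j; rewrite [RHS]mxE [j]ord1.
  have := position_normal_at_max oU Ux (FU 2%N) Fmax (delta_mx 0 i).
  rewrite dotpC -mul_jacobian -rowE /dotp -row_mul mxE; exact.
have [N [U' [r [[oU' U'x] sU' NU' NE [r0 wN]]]]] := normal_field xU FU Jfree w0 Jw.
have FU' : smooth_on U' F by move=> k; apply: C_on_sub (FU k).
have dN : differentiable N x by exact: smooth_on_differentiable NU'.
have Nperp v y : U' y -> dotp (N y) ('d F y v) = 0.
  move=> U'y; rewrite dotpC -mul_jacobian /dotp -mulmxA (NE y U'y).2 mulmx0.
  by rewrite mxE.
(* Differentiate [dotp (N y) (N y) = 1]; [w] is a multiple of [N x]. *)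
have JNw : 'J N x *m w^T = 0.
  have -> : w = - r *: N x by apply/eqP; rewrite scaleNr -addr_eq0 wN.
  rewrite linearZ /= -scalemxAr; apply/eqP; rewrite scalemx_eq0; apply/orP; right.
  apply/eqP/matrixP => i j; rewrite [RHS]mxE [j]ord1.
  have d1 := is_derive_dotp dN dN (erefl ('d N x (delta_mx 0 i))) erefl.
  have d0 : is_derive x (delta_mx 0 i : 'rV[R]_n) (fun y => dotp (N y) (N y)) 0.
    apply: near_eq_is_derive (is_derive_cst (1 : R) x _).
    have : \forall y \near x, U' y by exact: open_nbhs_nbhs.
    by apply: filterS => y U'y; rewrite (NE y U'y).1.
  have := @derive_val _ _ _ _ _ _ _ d1; rewrite (@derive_val _ _ _ _ _ _ _ d0).
  rewrite (dotpC (N x)) -mul_jacobian -rowE => /esym/eqP.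
  rewrite -mulr2n mulrn_eq0/= => /eqP; rewrite /dotp -row_mul mxE; exact.
have [A AJ] : exists A, A *m 'J F x = - 'J N x.
  by apply: (perp_rowspan w0 Jw Jfree); rewrite mulNmx JNw oppr0.
exists (N \o cmap c), c, A; split=> //.
- apply: unit_normal_near_chart NU' _ NE => // y U'y im.
  by rewrite (FE _ (sU' _ U'y) im).
- exists ('J F x), ('J N x); split=> //; first by exists F.
  exists N => //; exists U'; split=> // y _ [q cq <-].
  by rewrite /= cmapK.
left => k /eigenvalueP[v vA v0].
pose u := v *m 'J F x.
have u0 : 0 < dotp u u.
  rewrite dotp_gt0; apply: contraNneq v0 => u0.
  by apply/eqP/(row_free_inj Jfree); rewrite mul0mx.
have dNu : 'd N x v = - (k *: u).
  rewrite -mul_jacobian -[_ *m 'J N x]opprK -mulmxN -AJ mulmxA vA.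
  by rewrite -scalemxAl.
have h := second_order_at_max oU' U'x (FU' 2%N) Fmax dN (esym (mul_jacobian F x v))
  dNu (Nperp v) wN.
have : 0 < r * k * dotp u u.
  move: h; rewrite -/u dotpNl dotpZl mulrN mulrA subr_le0; exact: lt_le_trans.
by rewrite pmulr_lgt0// pmulr_rgt0.
Qed.

End Ellipticity.

Theorem theorem1 (R : realType) (n : nat) (M : manifold R n)
  (f : M -> 'rV[R]_n.+1)
  (f_immersion : immersion f)
  (M_compact : compact [set: M])
  (M_connected : connected [set: M])
  (bd_nonempty : boundary M !=set0)
  (not_in_hull : ~ (range f `<=` conv_hull (f @` boundary M))) :
  exists p : M, elliptic f p.
Proof.
have cf := immersion_continuous f_immersion.
have cB : compact (boundary M).
  by apply: subclosed_compact M_compact _ => //; exact: closed_boundary.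
have cK : compact (f @` boundary M).
  by apply: continuous_compact => //; exact: continuous_subspaceT.
have K0 : f @` boundary M !=set0 by case: bd_nonempty => b Bb; exists (f b), b.
have [q0 q0K] : exists q, ~ conv_hull (f @` boundary M) (f q).
  by apply/existsNP => h; apply: not_in_hull => _ [q _ <-].
have [ctr Kctr] := sphere_separation cK K0 q0K.
pose dist q := dotp (f q - ctr) (f q - ctr).
have cdist : continuous dist.
  move=> q; have cfo : {for q, continuous (fun q => f q - ctr)}.
    by apply: cvgB; [exact: cf | exact: cvg_cst].
  exact: (dotp_continuous cfo cfo).
have [|p _ pmax] := compact_EVT_max _ M_compact (continuous_subspaceT cdist).
  by exists q0.
have {}pmax q : dist q <= dist p by apply: pmax; rewrite inE.
have pint : ~ boundary M p.
  move=> bp; have := Kctr (f p); rewrite ltNge => /(_ _)/negP; apply; first by exists p.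
  exact: pmax.
have fpo : f p != ctr.
  have [b Bb] := bd_nonempty.
  have : 0 < dist p.
    apply: lt_le_trans (pmax q0); apply: le_lt_trans (Kctr _ _); last by exists b.
    exact: dotp_ge0.
  by rewrite dotp_gt0 subr_eq0.
have [c ac cp] := atlas_cover p.
by exists p; apply: (@farthest_point_elliptic _ _ _ f p c ac cp pint ctr).
Qed.
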